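(* Let $E$ be a finite nonempty set and $u:2^E\to\mathbb{R}$ ordinally w-concave. For $X\in 2^E$ let $\mathbf{C}_u(X)=\operatorname{Arg}\max\{u(Y)\mid Y\subseteq X\}$, and for $U\in 2^E$ let $\mathbf{C}_u^{-1}(U)=\{X\in 2^E\mid U\in\mathbf{C}_u(X)\}$. Then for any $U\in 2^E$ with $\mathbf{C}_u^{-1}(U)\neq\emptyset$ there exists a unique set $U^+\in 2^E$ such that $\mathbf{C}_u^{-1}(U)=[U,U^+]=\{X\in 2^E\mid U\subseteq X\subseteq U^+\}$.
   Context: Notation: for $X\subseteq E$ and $x\in E\setminus X$, $X+x=X\cup\{x\}$; for $x\in X$, $X-x=X\setminus\{x\}$. The symbol $\emptyset$ is also used as a formal element not in $E$, with $X+\emptyset=X-\emptyset=X$. A function $u:2^E\to\mathbb{R}$ is ordinally w-concave if for every $X,X'\in 2^E$ with $X\neq X'$ there exist distinct $x\in(X\setminus X')\cup\{\emptyset\}$ and $x'\in(X'\setminus X)\cup\{\emptyset\}$ such that (i) $u(X)<u(X-x+x')$, or (ii) $u(X')<u(X'-x'+x)$, or (iii) $u(X)=u(X-x+x')$ and $u(X')=u(X'-x'+x)$. *)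

(* Defs.v *)
From HB Require Import structures.
From mathcomp Require Import all_boot all_order all_algebra.
From mathcomp Require Import reals.

Set Implicit Arguments.
Unset Strict Implicit.
Unset Printing Implicit Defensive.

Import Order.TTheory GRing.Theory Num.Theory.

Local Open Scope ring_scope.

(* The formal element "emptyset" outside E, with X + emptyset = X - emptyset = X,
   is encoded by None : option E. *)

Definition addo (E : finType) (X : {set E}) (x : option E) : {set E} :=
  if x is Some y then y |: X else X.

Definition subo (E : finType) (X : {set E}) (x : option E) : {set E} :=
  if x is Some y then X :\ y else X.

Definition ino (E : finType) (x : option E) (A : {set E}) : bool :=
  if x is Some y then y \in A else true.

Definition ordinally_w_concave (R : realType) (E : finType)
    (u : {set E} -> R) : Prop :=
  forall X X' : {set E}, X <> X' ->
  exists x x' : option E,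
    [/\ ino x (X :\: X'), ino x' (X' :\: X), x <> x' &
        [\/ u X < u (addo (subo X x) x'),
            u X' < u (addo (subo X' x') x) |
            u X = u (addo (subo X x) x') /\ u X' = u (addo (subo X' x') x)]].

Definition choice_corr (R : realType) (E : finType) (u : {set E} -> R)
    (X : {set E}) : {set {set E}} :=
  [set Y : {set E} | (Y \subset X) &&
     [forall Z : {set E}, (Z \subset X) ==> (u Z <= u Y)]].

Definition choice_corr_inv (R : realType) (E : finType) (u : {set E} -> R)
    (U : {set E}) : {set {set E}} :=
  [set X : {set E} | U \in choice_corr u X].

Definition set_itv (E : finType) (A B : {set E}) : {set {set E}} :=
  [set X : {set E} | (A \subset X) && (X \subset B)].

(* Main.v *)
Require Import Defs.
From mathcomp Require Import all_boot all_order all_algebra.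
From mathcomp Require Import reals.

(** Under ordinal w-concavity, a set [U] that no single exchange inside [W]
    improves is a maximizer of [u] on the subsets of [W]: otherwise take a
    maximizer [Z] with smallest symmetric difference to [U]; the exchange between
    [U] and [Z] can improve neither, so it keeps both values and brings [Z] closer
    to [U].  A single exchange adds at most one element, so if [U] is chosen from
    every member of a family, it is unimprovable inside the union of the family;
    hence the union of all sets from which [U] is chosen is the required [U^+]. *)

Set Implicit Arguments.
Unset Strict Implicit.
Unset Printing Implicit Defensive.

Import Order.TTheory.

Section Exchange.
Variable E : finType.
Implicit Types (X U Z W : {set E}) (x z : option E).

Definition symdist Z U : nat := #|Z :\: U| + #|U :\: Z|.

Lemma in_addo X x (y : E) : (y \in addo X x) = (Some y == x) || (y \in X).
Proof. by case: x => [x|] //=; rewrite !inE. Qed.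

Lemma in_subo X x (y : E) : (y \in subo X x) = (Some y != x) && (y \in X).
Proof. by case: x => [x|] //=; rewrite !inE. Qed.

Lemma subset_exchange {Z W z x} :
  Z \subset W -> ino x W -> addo (subo Z z) x \subset W.
Proof.
move=> ZW xW; have ZzW : subo Z z \subset W.
  by case: z => [z|] //=; apply: subset_trans (subsetDl _ _) ZW.
by case: x xW => [x|] //= xW; rewrite subUset sub1set xW.
Qed.

Lemma ino_setD {A B W : {set E}} {x} : A \subset W -> ino x (A :\: B) -> ino x W.
Proof. by case: x => [x|] //= AW /setDP[/(subsetP AW)]. Qed.

(** Removing [z] shrinks [Z :\: U] and adding [x] shrinks [U :\: Z], each by one unless the element
    is [None]. *)
Lemma symdist_exchange {Z U z x} : ino z (Z :\: U) -> ino x (U :\: Z) -> x <> z ->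
  symdist (addo (subo Z z) x) U < symdist Z U.
Proof.
set Z' := addo _ _ => zZ xU xz.
have sub1 : Z' :\: U \subset subo (Z :\: U) z.
  apply/subsetP=> y; rewrite in_subo !inE in_addo in_subo => /andP[yU].
  case/orP => [/eqP yx|/andP[-> ->]]; last by rewrite yU.
  by move: xU; rewrite -yx /= inE (negbTE yU) andbF.
have sub2 : U :\: Z' \subset subo (U :\: Z) x.
  apply/subsetP=> y; rewrite in_subo !inE in_addo in_subo negb_or.
  (* Since [y] lies in [U], it is not the removed [z], so it was already missing from [Z]. *)
  case/andP=> /andP[-> yZ] yU; rewrite yU andbT /=; apply: contra yZ => ->.
  by rewrite andbT; apply: contraTneq zZ => <- /=; rewrite inE yU.
have card_subo (A : {set E}) (a : option E) : ino a A ->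
    #|subo A a| + isSome a = #|A|.
  by case: a => [a|] //= aA; rewrite ?addn0 // (cardsD1 a A) aA addnC.
rewrite /symdist -(card_subo _ _ zZ) -(card_subo _ _ xU).
apply: leq_ltn_trans (leq_add (subset_leq_card sub1) (subset_leq_card sub2)) _.
(* What remains is [0 < isSome z + isSome x]: [x <> z] forbids that both are [None]. *)
rewrite addnACA -[ltnLHS]addn0 ltn_add2l.
by case: z x xz {zZ xU Z' sub1 sub2} => [z|] [x|].
Qed.

End Exchange.

Section Choice.
Local Open Scope ring_scope.
Variables (R : realType) (E : finType) (u : {set E} -> R).
Implicit Types U V W X Y Z : {set E}.

Lemma choice_corrP X Y :
  reflect (Y \subset X /\ forall Z, Z \subset X -> u Z <= u Y)
          (Y \in choice_corr u X).
Proof.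
rewrite inE; apply: (iffP andP) => -[YX].
  by move=> /forallP h; split=> // Z ZX; apply: (implyP (h Z)).
by move=> h; split=> //; apply/forallP => Z; apply/implyP/h.
Qed.

(** The local condition restricts only the added [z], so it can be checked in any subset of [W] that
    contains [U] and [z]. *)
Lemma choice_corr_of_exchange U W : ordinally_w_concave u -> U \subset W ->
  (forall x z, ino z W -> u (addo (subo U x) z) <= u U) ->
  U \in choice_corr u W.
Proof.
move=> hu UW locU.
case: (@arg_maxP _ _ _ U (fun Z => Z \subset W) u UW) => M MW maxM.
have PM : (M \subset W) && (u M == u M) by rewrite eqxx andbT.
case: (@arg_minnP _ M (fun Z => (Z \subset W) && (u Z == u M)) (fun V => symdist V U) PM).
move=> Z /andP[ZW /eqP uZ] minZ.
case: (eqVneq U Z) => [UZ|/eqP /hu[x [z [xU zZ xz]]]].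
  by apply/choice_corrP; split=> // V VW; rewrite UZ uZ; apply: maxM.
have zW := ino_setD ZW zZ; have xW := ino_setD UW xU.
have Z'W := subset_exchange ZW xW (z := z).
(* Only the tie survives; it yields a maximizer closer to [U] than [Z]. *)
case=> [|| [_ eqZ]]; first by rewrite ltNge locU.
  by rewrite ltNge uZ [_ <= _](maxM _ Z'W).
have := minZ (addo (subo Z z) x); rewrite Z'W -eqZ uZ eqxx => /(_ isT).
by rewrite leqNgt (symdist_exchange zZ xU xz).
Qed.

Lemma choice_corr_bigcup U (F : {set {set E}}) : ordinally_w_concave u ->
  F != set0 -> {in F, forall X, U \in choice_corr u X} ->
  U \in choice_corr u (\bigcup_(X in F) X).
Proof.
move=> hu /set0Pn[X0 X0F] FU.
have [UX0 _] := choice_corrP _ _ (FU X0 X0F).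
apply: choice_corr_of_exchange => // [|x z zW].
  exact: subset_trans UX0 (bigcup_sup X0 X0F).
(* For [z = None] any member of [F] serves, hence [X0]. *)
have [X XF zX] : exists2 X, X \in F & ino z X.
  by case: z zW => [z /bigcupP|_] //; exists X0.
have [UX maxU] := choice_corrP _ _ (FU X XF).
exact/maxU/subset_exchange.
Qed.

(** Fewer competitors remain in [X]; this fills the interval below [U^+]. *)
Lemma choice_corr_sub U X Y : U \subset X -> X \subset Y ->
  U \in choice_corr u Y -> U \in choice_corr u X.
Proof.
move=> UX XY /choice_corrP[_ maxU]; apply/choice_corrP; split=> // Z ZX.
exact/maxU/(subset_trans ZX).
Qed.

End Choice.

Theorem theorem3p7 (R : realType) (E : finType) (hE : 0 < #|E|)
    (u : {set E} -> R) (hu : ordinally_w_concave u)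
    (U : {set E}) (hU : choice_corr_inv u U <> set0) :
  exists! Up : {set E}, choice_corr_inv u U = set_itv U Up.
Proof.
set Up := \bigcup_(X in choice_corr_inv u U) X.
have chosenUp : U \in choice_corr u Up.
  by apply: choice_corr_bigcup => //; [apply/eqP | move=> X; rewrite inE].
have [UUp _] := choice_corrP _ _ _ chosenUp.
have itvE : choice_corr_inv u U = set_itv U Up.
  apply/setP=> X; rewrite [in RHS]inE; apply/idP/andP => [UX|[UX XUp]].
    split; last exact: (bigcup_sup X UX).
    by move: UX; rewrite inE => /choice_corrP[].
  by rewrite inE; apply: choice_corr_sub XUp chosenUp.
exists Up; split=> // V; rewrite itvE => /setP eqV.
(* Each of the equal intervals contains its own top, so each top lies below the other. *)
have /andP[_ UpV] : (U \subset Up) && (Up \subset V).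
  by have := eqV Up; rewrite !inE subxx UUp andbT => <-.
have := eqV V; rewrite !inE subxx (subset_trans UUp UpV) /= => VUp.
by apply/eqP; rewrite eqEsubset UpV VUp.
Qed.
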